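(* Let $D\subset\mathbb{C}$ be a closed disk centered at the origin. If $D$ is sufficiently small (i.e. its radius is sufficiently small), then $$R\Big[z^2, \frac{\overline z}{1+\overline z}; D\Big]=C(D).$$
   Context: For a closed disk $D\subset\mathbb{C}$, $C(D)$ is the algebra of complex-valued continuous functions on $D$ with the supremum norm. For continuous functions $f,g$ on $D$, $R[f,g;D]$ denotes the uniform closure on $D$ of the functions of the form $z\mapsto P(f(z),g(z))/Q(f(z),g(z))$, where $P,Q$ are polynomials in two complex variables and $Q(f(z),g(z))\neq 0$ for all $z\in D$ (i.e. rational functions in the variables $f$ and $g$ without poles on $\{(f(z),g(z)):z\in D\}$). Here $f(z)=z^2$ and $g(z)=\overline z/(1+\overline z)$. *)

(* Defs.v *)
(* MathComp-Analysis + real_closed's complex numbers R[i]. *)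
From HB Require Import structures.
From mathcomp Require Import all_boot all_order all_algebra.
From mathcomp Require Import all_classical all_reals all_analysis.
From mathcomp Require Import complex.
Import Order.TTheory GRing.Theory Num.Theory ComplexField.
Import numFieldNormedType.Exports.

Set Implicit Arguments.
Unset Strict Implicit.
Unset Printing Implicit Defensive.

Local Open Scope classical_set_scope.
Local Open Scope ring_scope.

(* The standard (norm-induced) topology on R[i]: the library provides it for
   every numFieldType through R^o; we copy it onto R[i] itself. *)
Section ComplexTopology.
Variable R : rcfType.
HB.instance Definition _ := PseudoPointedMetric.copy R[i] R[i]^o.
End ComplexTopology.

Section Defs.
Variable R : realType.

(* closed disk of radius r centered at the origin *)
Definition closed_disk (r : R) : set R[i] := [set z | `|z| <= (r%:C)%C].

(* f(z) = z^2 and g(z) = conj(z) / (1 + conj(z)) *)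
Definition fz (z : R[i]) : R[i] := z ^+ 2.
Definition gz (z : R[i]) : R[i] := z^* / (1 + z^*).

(* evaluation of a polynomial in two complex variables,
   P(x, y) = sum_{i,j < n} c_{ij} x^i y^j *)
Definition bipoly_eval (n : nat) (c : 'I_n -> 'I_n -> R[i]) (x y : R[i]) : R[i] :=
  \sum_(i < n) \sum_(j < n) c i j * x ^+ i * y ^+ j.

(* R[f, g; D]: uniform closure on D of the functions P(f,g)/Q(f,g) with
   Q(f(z), g(z)) <> 0 for all z in D. Functions are represented as maps
   R[i] -> R[i]; only their values on D matter. *)
Definition rat_uniform_closure (f g : R[i] -> R[i]) (D : set R[i])
    (h : R[i] -> R[i]) : Prop :=
  forall eps : R, 0 < eps ->
    exists (n : nat) (P Q : 'I_n -> 'I_n -> R[i]),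
      (forall z, D z -> bipoly_eval Q (f z) (g z) != 0) /\
      (forall z, D z ->
         `|h z - bipoly_eval P (f z) (g z) / bipoly_eval Q (f z) (g z)|
           < (eps%:C)%C).

(* C(D): continuous functions on D *)
Definition CD (D : set R[i]) (h : R[i] -> R[i]) : Prop :=
  {within D, continuous h}.

End Defs.

(* Main.v *)
Require Import Defs.
From HB Require Import structures.
From mathcomp Require Import all_boot all_order all_algebra.
From mathcomp Require Import all_classical all_reals all_analysis.
From mathcomp Require Import complex.
From mathcomp Require Import ring lra.
Import Order.TTheory GRing.Theory Num.Theory ComplexField.
Import numFieldNormedType.Exports.
Local Open Scope classical_set_scope.
Local Open Scope ring_scope.

Set Implicit Arguments.
Unset Strict Implicit.
Unset Printing Implicit Defensive.

Local Notation normc := (@Normc.normc _).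

(* Since 1 - g = 1 / (1 + conj z), the closure A contains conj z = g / (1 - g).
   It also contains |z|^4 = f * (conj z)^2, hence its square root |z|^2: the
   real-valued functions of A form a uniformly closed algebra, and such an
   algebra is stable under square roots, absolute values and minima. Then
   z is the uniform limit of
     z (1 - (1 - |z|^2)^N) = conj z * f * sum_(i < N) (1 - |z|^2)^i,
   so A contains z and conj z, and with them all the distances w |-> |w - z|.
   Minima of finitely many functions h y + L * |w - y| then approximate every
   real-valued continuous function h. *)

(** * Uniformly closed algebras of bounded real functions: square roots, minima, approximation by
    cones *)

Record uniform_algebra (R : realType) (T : Type) (D : set T)
    (A : set (T -> R)) : Prop := UniformAlgebra {
  ualg_cst : forall c, A (fun=> c);
  ualgD : forall u v, A u -> A v -> A (fun x => u x + v x);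
  ualgM : forall u v, A u -> A v -> A (fun x => u x * v x);
  ualg_bounded : forall u, A u -> exists M, forall x, D x -> `|u x| <= M;
  ualg_closed : forall u,
    (forall e, 0 < e -> exists2 v, A v & forall x, D x -> `|u x - v x| < e) ->
    A u }.

Section UniformAlgebra.
Variables (R : realType) (T : Type) (D : set T) (A : set (T -> R)).
Hypothesis algA : uniform_algebra D A.
Implicit Types u v : T -> R.

(** Uniform closedness only looks at [D], so changing a function outside [D] keeps it in [A]. *)
Lemma ualg_eq u v : A u -> (forall x, D x -> u x = v x) -> A v.
Proof.
move=> Au uv; apply: (ualg_closed algA) => e e0.
by exists u => // x Dx; rewrite uv // subrr normr0.
Qed.

Lemma ualgZ c u : A u -> A (fun x => c * u x).
Proof. by move=> Au; apply: (ualgM algA) => //; apply: ualg_cst algA _. Qed.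

Lemma ualgB u v : A u -> A v -> A (fun x => u x - v x).
Proof.
move=> Au Av; apply: (@ualg_eq (fun x => u x + (-1) * v x)).
  by apply: (ualgD algA) => //; apply: ualgZ.
by move=> x _; rewrite mulN1r.
Qed.

(** The classical iteration that increases to the square root of [t] on [0, 1]. Each iterate is a
    polynomial in [t], so it can be formed inside an algebra. *)
Definition sqrt_iter (n : nat) (t : R) : R :=
  iter n (fun p => p + (t - p ^+ 2) / 2) 0.

Lemma sqrt_iterS n t :
  sqrt_iter n.+1 t = sqrt_iter n t + (t - sqrt_iter n t ^+ 2) / 2.
Proof. by []. Qed.

(* The error s - p_n satisfies s - p_(n+1) = (s - p_n) (1 - (s + p_n) / 2). *)
Lemma sqrt_iterP n (s : R) : 0 <= s <= 1 ->
  0 <= sqrt_iter n (s ^+ 2) <= s /\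
  (s - sqrt_iter n (s ^+ 2)) * (2 + n%:R * s) <= 2 * s.
Proof.
move=> /andP[s0 s1]; elim: n => [|n [/andP[p0 ps] IH]].
  by rewrite /= lexx s0 subr0 mul0r addr0 mulrC.
rewrite sqrt_iterS -[n.+1%:R]natr1; move: (sqrt_iter n _) p0 ps IH => p p0 ps IH.
have -> : s - (p + (s ^+ 2 - p ^+ 2) / 2) = (s - p) * (1 - (s + p) / 2) by field.
have n0 : 0 <= n%:R :> R by [].
split.
  have : 0 <= (s - p) * (s + p) by apply: mulr_ge0; lra.
  rewrite -subr_sqr => sp; apply/andP; split; first lra.
  have : 0 <= (s - p) * (1 - (s + p) / 2) by apply: mulr_ge0; lra.
  lra.
apply: le_trans IH; rewrite -mulrA; apply: ler_wpM2l; first lra.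
(* The remaining claim (1 - (s + p) / 2) (2 + (n + 1) s) <= 2 + n s amounts to s <= (s + p) / 2 * (2
   + (n + 1) s), which follows from p >= 0. *)
have ns0 : 0 <= (n%:R + 1) * s by rewrite mulr_ge0 ?addr_ge0.
have : s / 2 * 2 <= (s + p) / 2 * (2 + (n%:R + 1) * s) by apply: ler_pM; lra.
lra.
Qed.

Lemma ualg_sqrt_iter n u : A u -> A (fun x => sqrt_iter n (u x)).
Proof.
move=> Au; elim: n => [|n IH]; first exact: ualg_cst algA _.
under eq_fun do rewrite sqrt_iterS.
apply: (ualgD algA) => //.
apply: (ualgM algA); last exact: ualg_cst algA _.
by apply: ualgB => //; under eq_fun do rewrite expr2; apply: (ualgM algA).
Qed.

Lemma ualg_sqrt01 u : A u -> (forall x, D x -> 0 <= u x <= 1) ->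
  A (fun x => Num.sqrt (u x)).
Proof.
move=> Au u01; apply: (ualg_closed algA) => e e0.
(* The error bound of [sqrt_iterP] yields s - p_n <= 2 / n whatever s is, so any n > 2 / e will
   do. *)
have : 0 <= 2 / e by rewrite divr_ge0 // ltW.
move=> /archi_boundP; set n := Num.bound _; rewrite ltr_pdivrMr // => ne.
exists (fun x => sqrt_iter n (u x)); first exact: ualg_sqrt_iter.
move=> x /u01 /andP[u0 u1]; set s := Num.sqrt (u x).
have s01 : 0 <= s <= 1 by rewrite sqrtr_ge0 -sqrtr1 ler_sqrt.
have -> : u x = s ^+ 2 by rewrite sqr_sqrtr.
have [/andP[p0 ps]] := sqrt_iterP n s01.
move: s01 => /andP[s0 _].
rewrite ger0_norm ?subr_ge0 //; move: (sqrt_iter _ _) p0 ps => p p0 ps H.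
have [s00|sn0] := eqVneq s 0; first lra.
have {sn0 s0} s0 : 0 < s by rewrite lt0r sn0.
have : (s - p) * n%:R <= 2.
  rewrite -(ler_pM2r s0); apply: le_trans H.
  have : 0 <= s - p by lra.
  lra.
move=> {}H; rewrite -(@ltr_pM2r _ n%:R); last by rewrite -(ltr_pM2r e0); lra.
lra.
Qed.

Lemma ualg_sqrt u : A u -> (forall x, D x -> 0 <= u x) ->
  A (fun x => Num.sqrt (u x)).
Proof.
move=> Au u0; have [M uM] := ualg_bounded algA Au.
(* Dividing by a positive bound of [u] brings its values into [0, 1]. *)
pose N := `|M| + 1; have N0 : 0 < N by rewrite ltr_wpDl.
apply: (@ualg_eq (fun x => Num.sqrt N * Num.sqrt (N^-1 * u x))).
  apply/ualgZ/ualg_sqrt01; first exact: ualgZ.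
  move=> x Dx; rewrite mulr_ge0 ?u0 ?invr_ge0 ?(ltW N0) //=.
  rewrite mulrC ler_pdivrMr // mul1r; have := uM x Dx.
  by rewrite ger0_norm ?u0 // /N; have := ler_norm M; lra.
by move=> x Dx; rewrite -sqrtrM ?(ltW N0) // mulrA divff ?gt_eqF // mul1r.
Qed.

Lemma ualg_norm u : A u -> A (fun x => `|u x|).
Proof.
move=> Au; under eq_fun do rewrite -sqrtr_sqr expr2.
by apply: ualg_sqrt => [|x _]; [apply: (ualgM algA)|rewrite -expr2 sqr_ge0].
Qed.

Lemma ualg_min u v : A u -> A v -> A (fun x => Num.min (u x) (v x)).
Proof.
move=> Au Av; under eq_fun do rewrite minr_absE.
apply: (ualgM algA); last exact: ualg_cst algA _.
by apply: ualgB; [apply: (ualgD algA)|apply/ualg_norm/ualgB].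
Qed.

End UniformAlgebra.

(* [h] is uniformly approximated by the minima, over a finite net, of the cones
   [h y + L * d y x] with a large slope [L]. *)
Lemma ualg_unif_continuous (R : realType) (T : eqType) (D : set T)
    (A : set (T -> R)) (d : T -> T -> R) (h : T -> R) :
  uniform_algebra D A ->
  (forall y, D y -> A (d y)) ->
  (forall x y, 0 <= d y x) ->
  (forall e, 0 < e -> exists2 s : seq T, {in s, forall y, D y} &
     forall x, D x -> exists2 y, y \in s & d y x < e) ->
  (forall e, 0 < e -> exists2 k, 0 < k &
     forall x y, D x -> D y -> d y x < k -> `|h y - h x| < e) ->
  A h.
Proof.
move=> algA Ad d0 net unif.
have [M hM] : exists M, forall x, D x -> `|h x| <= M.
  have [k k0 hk] := unif 1 ltr01; have [s sD snet] := net k k0.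
  have [M HM] : exists M, forall y, y \in s -> `|h y| <= M.
    elim: s {sD snet} => [|a s [M IH]]; first by exists 0.
    exists (Num.max `|h a| M) => y; rewrite inE => /orP[/eqP ->|/IH].
      by rewrite le_max lexx.
    by rewrite le_max => ->; rewrite orbT.
  exists (M + 1) => x Dx; have [y ys dyx] := snet x Dx.
  have := hk x y Dx (sD y ys) dyx; have := HM y ys.
  by have := ler_normB (h y) (h y - h x); rewrite subKr; lra.
apply: (ualg_closed algA) => e e0.
have [k k0 hk] := unif (e / 2) ltac:(lra).
(* At distance [k] a cone has risen by 2|M|, which puts it above [h]. Within distance [eta] it rises
   by less than e / 2; the + 1 keeps the divisor positive when L = 0. *)
pose L := 2 * `|M| / k.
have L0 : 0 <= L by rewrite divr_ge0 ?mulr_ge0 // ltW.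
pose eta := Num.min k (e / 2 / (L + 1)).
have eta0 : 0 < eta by rewrite lt_min k0 divr_gt0 //; lra.
have [s sD snet] := net eta eta0.
pose cone y x := h y + L * d y x.
(* Starting the minimum at [M], an upper bound of [h] on [D], keeps the lower estimate valid for an
   empty net. *)
pose g x := foldr (fun y => Num.min (cone y x)) M s.
exists g.
  rewrite /g; elim: s sD {snet g} => [|y s IH] sD /=; first exact: ualg_cst algA _.
  apply: (ualg_min algA); last by apply: IH => z zs; apply: sD; rewrite inE zs orbT.
  apply: (ualgD algA); first exact: ualg_cst algA _.
  by apply/(ualgZ algA)/Ad/sD; rewrite inE eqxx.
move=> x Dx.
have ge_g : h x - e / 2 < g x.
  rewrite /g; elim: s sD {snet g} => [|y s IH] sD /=.
    by have := hM x Dx; have := ler_norm (h x); lra.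
  rewrite lt_min IH ?andbT; last by move=> z zs; apply: sD; rewrite inE zs orbT.
  have Dy : D y by apply: sD; rewrite inE eqxx.
  (* Close to [y], uniform continuity bounds the cone from below; far from [y], the slope does. *)
  rewrite /cone; have [dk|dk] := ltP (d y x) k.
    have := hk x y Dx Dy dk; rewrite ltr_norml => /andP[+ _].
    have : 0 <= L * d y x by apply: mulr_ge0.
    lra.
  have : L * k <= L * d y x by apply: ler_wpM2l.
  rewrite {1}/L divfK ?gt_eqF //.
  have := hM x Dx; have := hM y Dy; have := ler_norm M.
  by rewrite !ler_norml => ? /andP[? ?] /andP[? ?]; lra.
(* For the upper estimate one cone suffices, that of a net point within [eta] of [x]: it costs e / 2
   for [h] and e / 2 for the slope. *)
have [y ys dyx] := snet x Dx.
have g_le : g x <= cone y x.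
  rewrite /g; elim: s ys {sD snet g ge_g} => [//|z s IH] /=.
  rewrite inE => /orP[/eqP <-|/IH zs]; first by rewrite ge_min lexx.
  by rewrite ge_min zs orbT.
move: dyx; rewrite lt_min => /andP[dk].
rewrite ltr_pdivlMr; last lra.
have := hk x y Dx (sD y ys) dk; rewrite ltr_norml => /andP[_ hyx] dL.
move: g_le; rewrite /cone ltr_norml => g_le.
have := d0 x y; lra.
Qed.

(** * Polynomials in two variables and a restatement of the closure *)

(** The outer variable of [{poly {poly R[i]}}] stands for y and the inner one for x, hence the order
    of the indices in the coefficient. The square array must be large enough for both degrees. *)
Lemma bipoly_eval_coef (R : realType) (p : {poly {poly R[i]}}) n x y :
  (size p <= n)%N -> (polyXY.sizeY p <= n)%N ->
  bipoly_eval (fun i j : 'I_n => p`_j`_i) x y = p.[y%:P].[x].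
Proof.
move=> pn pYn; rewrite /bipoly_eval exchange_big (horner_coef_wide _ pn) horner_sum.
apply: eq_bigr => j _; rewrite hornerM -polyC_exp hornerC.
rewrite (@horner_coef_wide _ n) ?mulr_suml //.
exact: leq_trans (polyXY.max_size_coefXY p j) pYn.
Qed.

Lemma bipoly_eval_poly (R : realType) n (c : 'I_n -> 'I_n -> R[i]) :
  exists p : {poly {poly R[i]}}, forall x y, bipoly_eval c x y = p.[y%:P].[x].
Proof.
exists (\sum_(i < n) \sum_(j < n) (c i j *: 'X^i)%:P * 'X^j) => x y.
rewrite !horner_sum; apply: eq_bigr => i _; rewrite !horner_sum.
apply: eq_bigr => j _.
by rewrite hornerM hornerC hornerXn hornerM -polyC_exp hornerC hornerZ hornerXn.
Qed.

(** The norm on [R[i]] takes its values in [R[i]]; this is the same distance with values in [R],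
    where real arithmetic applies. *)
Definition cdist {R : realType} (y x : R[i]) : R := Normc.normc (y - x).

Lemma cdistE (R : realType) (x y : R[i]) : `|y - x| = (cdist y x)%:C%C.
Proof. by []. Qed.

(** With polynomials in place of coefficient arrays, sums and products of fractions become ring
    operations. *)
Lemma rat_uniform_closureP (R : realType) (f g : R[i] -> R[i]) D h :
  rat_uniform_closure f g D h <->
  forall e, 0 < e -> exists p q : {poly {poly R[i]}}, forall z, D z ->
    q.[(g z)%:P].[f z] != 0 /\
    cdist (h z) (p.[(g z)%:P].[f z] / q.[(g z)%:P].[f z]) < e.
Proof.
split=> H e /H.
  move=> [n [P [Q [Q0 hPQ]]]].
  have [p Pp] := bipoly_eval_poly P; have [q Qq] := bipoly_eval_poly Q.
  exists p, q => z Dz; rewrite -Pp -Qq; split; first exact: Q0.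
  by rewrite -ltcR -cdistE; apply: hPQ.
move=> [p [q pq]].
pose n := maxn (maxn (size p) (polyXY.sizeY p)) (maxn (size q) (polyXY.sizeY q)).
exists n, (fun i j => p`_j`_i), (fun i j => q`_j`_i).
by split=> z /pq[q0]; rewrite !bipoly_eval_coef ?leq_max ?leqnn ?orbT // -ltcR -cdistE.
Qed.

(** * Continuity and neighbourhoods in terms of the real-valued distance *)

Lemma gt0_complexE (R : realType) (e : R[i]) : 0 < e -> exists2 r : R, 0 < r & e = r%:C%C.
Proof.
by case: e => a b; rewrite ltcE /= => /andP[/eqP -> a0]; exists a.
Qed.

Lemma continuous_within_cdist (R : realType) (D : set R[i]) (h : R[i] -> R[i]) :
  CD D h <-> forall z, D z -> forall e, 0 < e ->
    \forall w \near within D (nbhs z), cdist (h z) (h w) < e.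
Proof.
rewrite /CD subspace_continuousP; split=> H z Dz.
  move=> e e0.
  have := (@cvgrPdist_lt _ R[i]^o _ _ _ h (h z)).1 (H z Dz) e%:C%C.
  rewrite ltcR => /(_ _ e0); apply: filterS.
  by move=> w; rewrite cdistE ltcR.
apply/(@cvgrPdist_lt _ R[i]^o) => e /gt0_complexE[{}e e0 ->].
by apply: filterS (H z Dz e e0) => w; rewrite cdistE ltcR.
Qed.

Section Normc.
Variable R : realType.
Implicit Types x y z : R[i].

Lemma normc_ge0 z : 0 <= normc z.
Proof. by case: z => a b; exact: sqrtr_ge0. Qed.

Lemma ler_normcD x y : normc (x + y) <= normc x + normc y.
Proof. exact: le_normcD. Qed.

Lemma normc_sub x y : normc (x - y) = normc (y - x).
Proof. by rewrite -opprB; exact: normcN. Qed.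

Lemma cdist_triangle y x z : cdist x z <= cdist x y + cdist y z.
Proof. by rewrite /cdist -[x - z](subrKA y); exact: ler_normcD. Qed.

Lemma cdistC x y : cdist x y = cdist y x.
Proof. exact: normc_sub. Qed.

Lemma normc_real (t : R) : normc t%:C%C = `|t|.
Proof. by rewrite /= expr0n addr0 sqrtr_sqr. Qed.

Lemma normc_conj z : normc z^* = normc z.
Proof. by case: z => a b /=; rewrite sqrrN. Qed.

Lemma normc_Re z : `|complex.Re z| <= normc z.
Proof. by rewrite -lecR; exact: normc_ge_Re. Qed.

Lemma normc_Im z : `|complex.Im z| <= normc z.
Proof.
case: z => a b; rewrite -[normc _]/(Num.sqrt (a ^+ 2 + b ^+ 2)) -sqrtr_sqr.
by apply: ler_wsqrtr; rewrite lerDr sqr_ge0.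
Qed.

Lemma normc_le_ReIm z : normc z <= `|complex.Re z| + `|complex.Im z|.
Proof.
rewrite {1}(complexE z); apply: le_trans (ler_normcD _ _) _.
rewrite Normc.normcM !normc_real.
by rewrite /= expr0n expr1n add0r sqrtr1 mul1r.
Qed.

Lemma nbhs_cdistP z (P : set R[i]) :
  nbhs z P <-> exists2 e, 0 < e & forall w, cdist z w < e -> P w.
Proof.
split.
  move=> /(@nbhs_ballP _ R[i]^o)[e /= /gt0_complexE[{}e e0 ->]] H.
  by exists e => // w zw; apply: H; rewrite /ball /= cdistE ltcR.
move=> [e e0 H]; apply/(@nbhs_ballP _ R[i]^o).
exists e%:C%C; first by rewrite /= ltcR.
by move=> w; rewrite /ball /= cdistE ltcR => /H.
Qed.

End Normc.

(** * Continuity of uniform limits and of rational functions *)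

Section CDLemmas.
Variables (R : realType) (D : set R[i]).
Implicit Types f g h : R[i] -> R[i].

Lemma within_cdist_lt z : D z -> forall e : R, 0 < e ->
  \forall w \near within D (nbhs z), cdist z w < e /\ D w.
Proof.
move=> Dz e e0; rewrite /within /=; apply/nbhs_cdistP; exists e => // w.
Qed.

(** The usual e / 3 argument. *)
Lemma CD_unif_lim h :
  (forall e : R, 0 < e -> exists2 q, CD D q & forall z, D z -> cdist (h z) (q z) < e) ->
  CD D h.
Proof.
move=> H; apply/continuous_within_cdist => z Dz e e0.
have [|q /continuous_within_cdist Cq hq] := H (e / 3); first lra.
have F : Filter (within D (nbhs z)) by apply: within_filter.
have Dw : \forall w \near within D (nbhs z), D w.
  by apply: filterS (within_cdist_lt Dz ltr01) => w [].
have e3 : 0 < e / 3 by lra.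
apply: filterS (filterI (Cq z Dz _ e3) Dw) => w [zw {}Dw].
have := cdist_triangle (q z) (h z) (h w); have := cdist_triangle (q w) (q z) (h w).
by have := hq z Dz; have := hq w Dw; rewrite [cdist (h w) _]cdistC; lra.
Qed.

(** Meant for the identity and for complex conjugation. *)
Lemma CD_isometry h : (forall z w, cdist (h z) (h w) = cdist z w) -> CD D h.
Proof.
move=> H; apply/continuous_within_cdist => z Dz e e0.
have F : Filter (within D (nbhs z)) by apply: within_filter.
by apply: filterS (within_cdist_lt Dz e0) => w []; rewrite H.
Qed.
End CDLemmas.

Lemma cvg_horner (K : numFieldType) (T : Type) (F : set_system T) (FF : Filter F)
    (p : {poly K}) (f : T -> K) (a : K) :
  f @ F --> a -> p.[f t] @[t --> F] --> p.[a].
Proof.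
move=> fa; elim/poly_ind: p => [|p c IH].
  by under eq_fun do rewrite horner0; rewrite horner0; exact: cvg_cst.
under eq_fun do rewrite hornerMXaddC.
by rewrite hornerMXaddC; apply: cvgD; [exact: cvgM|exact: cvg_cst].
Qed.

Lemma cvg_horner2 (K : numFieldType) (T : Type) (F : set_system T) (FF : Filter F)
    (p : {poly {poly K}}) (f g : T -> K) (a b : K) :
  f @ F --> a -> g @ F --> b -> p.[(g t)%:P].[f t] @[t --> F] --> p.[b%:P].[a].
Proof.
move=> fa gb; elim/poly_ind: p => [|p c IH].
  under eq_fun do rewrite !horner0.
  by rewrite !horner0; exact: cvg_cst.
under eq_fun do rewrite hornerMXaddC hornerD hornerM hornerC.
rewrite hornerMXaddC hornerD hornerM hornerC.
by apply: cvgD; [exact: cvgM|exact: cvg_horner].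
Qed.

Lemma cvg_rational (K : numFieldType) (T : Type) (F : set_system T) (FF : Filter F)
    (p q : {poly {poly K}}) (f g : T -> K) (a b : K) :
  f @ F --> a -> g @ F --> b -> q.[b%:P].[a] != 0 ->
  p.[(g t)%:P].[f t] / q.[(g t)%:P].[f t] @[t --> F] --> p.[b%:P].[a] / q.[b%:P].[a].
Proof.
move=> fa gb q0; apply: cvgM; first exact: cvg_horner2.
by apply: cvgV => //; exact: cvg_horner2.
Qed.

Lemma CD_rational (R : realType) (D : set R[i]) (f g : R[i] -> R[i])
    (p q : {poly {poly R[i]}}) : CD D f -> CD D g ->
  (forall z, D z -> q.[(g z)%:P].[f z] != 0) ->
  CD D (fun z => p.[(g z)%:P].[f z] / q.[(g z)%:P].[f z]).
Proof.
move=> /subspace_continuousP Cf /subspace_continuousP Cg q0.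
apply/subspace_continuousP => z Dz.
have F : Filter (within D (nbhs z)) by apply: within_filter.
exact: (@cvg_rational R[i] R[i] _ F p q f g (f z) (g z) (Cf z Dz) (Cg z Dz) (q0 z Dz)).
Qed.

(** The easy inclusion: pole-free rational functions of continuous functions are continuous, and so
    are their uniform limits. On a compact set it also makes the members of the closure bounded. *)
Lemma rat_uniform_closure_CD (R : realType) (D : set R[i]) (f g h : R[i] -> R[i]) :
  CD D f -> CD D g -> rat_uniform_closure f g D h -> CD D h.
Proof.
move=> Cf Cg /rat_uniform_closureP H; apply: CD_unif_lim => e /H[p [q pq]].
exists (fun z => p.[(g z)%:P].[f z] / q.[(g z)%:P].[f z]); last by move=> z /pq[].
by apply: CD_rational => // z /pq[].
Qed.

(** * Compactness of the closed disk *)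

Section Disk.
Variable R : realType.

Lemma closed_diskP (r : R) (z : R[i]) : closed_disk r z <-> normc z <= r.
Proof. by rewrite /closed_disk /= -lecR. Qed.

Lemma closed_disk_closed (r : R) : closed (closed_disk r : set R[i]).
Proof.
rewrite -openC openE => z; rewrite /setC /= => /closed_diskP/negP; rewrite -ltNge => rz.
apply/nbhs_cdistP; exists (normc z - r); first by rewrite subr_gt0.
move=> w zw /closed_diskP wr.
by have := ler_normcD (z - w) w; rewrite subrK; move: zw; rewrite /cdist; lra.
Qed.

Lemma continuous_Complex : continuous (fun p : R * R => Complex p.1 p.2).
Proof.
move=> [a b] P /= /nbhs_cdistP[e e0 H].
have e2 : 0 < e / 2 by lra.
exists (ball a (e / 2), ball b (e / 2)); first by split=> /=; exact: nbhsx_ballx.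
move=> [x y] /= [ax byy]; apply: H.
apply: le_lt_trans (normc_le_ReIm _) _ => /=.
by move: ax byy; rewrite /ball /=; lra.
Qed.

(** The disk is a closed subset of the continuous image of the compact square [-r, r] x [-r, r]. *)
Lemma compact_closed_disk (r : R) : compact (closed_disk r : set R[i]).
Proof.
have Q := compact_setX (@segment_compact R (- r) r) (@segment_compact R (- r) r).
have C : {within `[- r, r]%classic `*` `[- r, r]%classic,
    continuous (fun p : R * R => Complex p.1 p.2)}.
  exact/continuous_subspaceT/continuous_Complex.
apply: subclosed_compact (continuous_compact C Q) _; first exact: closed_disk_closed.
move=> [a b] /closed_diskP zr; exists (a, b) => //.
split => /=; rewrite in_itv /= -ler_norml.
  exact: le_trans (normc_Re (Complex a b)) zr.
exact: le_trans (normc_Im (Complex a b)) zr.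
Qed.

End Disk.

(** * The closure on a compact set is an algebra, and a Stone-Weierstrass criterion for it *)

Section CompactCD.
Variables (R : realType) (D : set R[i]).
Hypothesis cD : compact D.

Lemma compact_cdist_net (e : R) : 0 < e ->
  exists2 s : seq R[i], {in s, forall y, D y} &
    forall x, D x -> exists2 y, y \in s & cdist y x < e.
Proof.
move=> e0; move: cD; rewrite compact_cover => /(_ _ D (fun y => [set x | cdist y x < e])).
case.
- move=> y _; rewrite openE => x /= yx; apply/nbhs_cdistP.
  exists (e - cdist y x); first by rewrite subr_gt0.
  by move=> w xw /=; have := cdist_triangle x y w; lra.
- move=> x Dx; exists x => //=.
  by rewrite /cdist subrr Normc.normc0.
- move=> s sD cov; exists (finmap.enum_fset s) => [y ys|x Dx].
    by have := sD y ys; rewrite inE.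
  by have [y /= ys yx] := cov x Dx; exists y.
Qed.

(** Heine-Cantor: [P k x] says that [k] serves as modulus at [x], and the near-covering form of
    compactness turns local moduli into a common one. *)
Lemma compact_CD_unif (h : R[i] -> R[i]) : CD D h -> forall e : R, 0 < e ->
  exists2 k : R, 0 < k & forall x y, D x -> D y -> cdist y x < k -> cdist (h y) (h x) < e.
Proof.
move=> /continuous_within_cdist Ch e e0; move: cD => /compact_near_coveringP.
pose P (k : R) x := D x -> forall y, D y -> cdist y x < k -> cdist (h y) (h x) < e.
move=> /(_ R (at_right 0) P) H.
have [] : \forall k \near 0^'+, D `<=` P k.
  apply: H => x Dx; have e2 : 0 < e / 2 by lra.
  have [d d0 hd] := (nbhs_cdistP x _).1 (Ch x Dx _ e2).
  have d2 : 0 < d / 2 by lra.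
  (* With both halves below d / 2, [x'] and [y] lie within [d] of [x], so each value is within e / 2
     of [h x]. *)
  exists ([set x' | cdist x x' < d / 2], [set k | k < d / 2]).
    split => /=; first by apply/nbhs_cdistP; exists (d / 2).
    exact: nbhs_right_lt.
  move=> [x' k] /= [xx' kd] Dx' y Dy yx'.
  have := hd x' ltac:(lra) Dx'; have := hd y.
  have := cdist_triangle x' x y; rewrite [cdist x' y]cdistC => ? /(_ ltac:(lra) Dy).
  by have := cdist_triangle (h x) (h y) (h x'); rewrite [cdist (h y) (h x)]cdistC; lra.
(* Every positive number smaller than the radius [k] is a modulus; k / 2 is one. *)
move=> k /= k0 Hk; have k2 : 0 < k / 2 by lra.
exists (k / 2) => // x y Dx Dy; apply: (Hk (k / 2)) => //.
by rewrite /ball /= sub0r normrN gtr0_norm //; lra.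
Qed.

Lemma compact_CD_bounded (h : R[i] -> R[i]) : CD D h ->
  exists M : R, forall x, D x -> normc (h x) <= M.
Proof.
move=> Ch; have [k k0 hk] := compact_CD_unif Ch (@ltr01 R).
have [s sD snet] := compact_cdist_net k0.
(* The sum over the net is a crude bound for the maximum over it. *)
exists (\sum_(y <- s) normc (h y) + 1) => x Dx.
have [y ys yx] := snet x Dx; have := hk x y Dx (sD y ys) yx.
rewrite cdistC /cdist => hxy.
have := ler_normcD (h x - h y) (h y); rewrite subrK => H.
suff : normc (h y) <= \sum_(y <- s) normc (h y) by lra.
rewrite (big_rem y) //= lerDl; apply: sumr_ge0 => *; exact: normc_ge0.
Qed.

Variables f g : R[i] -> R[i].
Hypotheses (Cf : CD D f) (Cg : CD D g).
Local Notation A := (rat_uniform_closure f g D).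

Lemma ratcl_exact (p q : {poly {poly R[i]}}) h :
  (forall z, D z -> q.[(g z)%:P].[f z] != 0 /\
     h z = p.[(g z)%:P].[f z] / q.[(g z)%:P].[f z]) -> A h.
Proof.
move=> H; apply/rat_uniform_closureP => e e0; exists p, q => z /H[q0 ->].
by split=> //; rewrite /cdist subrr Normc.normc0.
Qed.

Lemma ratcl_cst c : A (fun=> c).
Proof.
apply: (@ratcl_exact c%:P%:P 1%:P%:P) => z _.
by rewrite !hornerC oner_neq0 divr1.
Qed.

Lemma ratcl_fst : A f.
Proof.
apply: (@ratcl_exact 'X%:P 1%:P%:P) => z _.
by rewrite !hornerC oner_neq0 divr1 hornerX.
Qed.

Lemma ratclD h k : A h -> A k -> A (fun z => h z + k z).
Proof.
move=> /rat_uniform_closureP Ah /rat_uniform_closureP Ak.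
apply/rat_uniform_closureP => e e0; have e2 : 0 < e / 2 by lra.
have [p [q pq]] := Ah _ e2; have [p' [q' pq']] := Ak _ e2.
exists (p * q' + p' * q), (q * q') => z Dz.
have [q0 hz] := pq z Dz; have [q'0 kz] := pq' z Dz.
rewrite !(hornerM, hornerD) mulf_neq0 //; split => //.
rewrite -addf_div // /cdist opprD addrACA.
by apply: le_lt_trans (ler_normcD _ _) _; move: hz kz; rewrite /cdist; lra.
Qed.

Lemma ratclM h k : A h -> A k -> A (fun z => h z * k z).
Proof.
move=> Ah Ak.
have [M hM] := compact_CD_bounded (rat_uniform_closure_CD Cf Cg Ah).
have [N kN] := compact_CD_bounded (rat_uniform_closure_CD Cf Cg Ak).
move: Ah Ak => /rat_uniform_closureP Ah /rat_uniform_closureP Ak.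
apply/rat_uniform_closureP => e e0.
(* The error h k - a b = h (k - b) + (h - a) b is below d (|M| + |N| + 1), because d <= 1 gives |b|
   <= |N| + 1. *)
pose B := `|M| + `|N| + 1; have B0 : 0 < B by rewrite ltr_wpDl // addr_ge0.
pose d := Num.min 1 (e / B); have d0 : 0 < d by rewrite lt_min ltr01 divr_gt0.
have [p [q pq]] := Ah _ d0; have [p' [q' pq']] := Ak _ d0.
exists (p * p'), (q * q') => z Dz.
have [q0 hz] := pq z Dz; have [q'0 kz] := pq' z Dz.
rewrite !hornerM mulf_neq0 //; split => //.
rewrite -mulf_div; set a := _ / _ in hz *; set b := _ / _ in kz *.
have -> : cdist (h z * k z) (a * b) =
    normc (h z * (k z - b) + (h z - a) * (k z - (k z - b))).
  by rewrite /cdist; congr normc; ring.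
apply: le_lt_trans (ler_normcD _ _) _; rewrite !Normc.normcM.
have dB : d * B <= e by rewrite -ler_pdivlMr // ge_min lexx orbT.
have d1 : d <= 1 by rewrite ge_min lexx.
apply: lt_le_trans dB.
have le1 : normc (h z) * normc (k z - b) <= `|M| * d.
  apply: ler_pM; rewrite ?normc_ge0 //; last exact: ltW.
  exact: le_trans (hM z Dz) (ler_norm M).
have le2 : normc (h z - a) * normc (k z - (k z - b)) <= normc (h z - a) * (`|N| + 1).
  apply: ler_wpM2l; first exact: normc_ge0.
  apply: le_trans (ler_normcD _ _) _; rewrite normcN.
  by have := kN z Dz; have := ler_norm N; move: kz; rewrite /cdist; lra.
have lt3 : normc (h z - a) * (`|N| + 1) < d * (`|N| + 1).
  by rewrite ltr_pM2r // ltr_wpDl.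
by rewrite /B; lra.
Qed.

Lemma ratcl_closed h :
  (forall e, 0 < e -> exists2 k, A k & forall z, D z -> cdist (h z) (k z) < e) -> A h.
Proof.
move=> H; apply/rat_uniform_closureP => e e0; have e2 : 0 < e / 2 by lra.
have [k /rat_uniform_closureP Ak hk] := H _ e2; have [p [q pq]] := Ak _ e2.
exists p, q => z Dz; have [q0 kz] := pq z Dz; split=> //.
by apply: le_lt_trans (cdist_triangle (k z) _ _) _; have := hk z Dz; lra.
Qed.

Lemma ratcl_eq h k : A h -> (forall z, D z -> h z = k z) -> A k.
Proof.
move=> Ah hk; apply: ratcl_closed => e e0; exists h => // z Dz.
by rewrite hk // /cdist subrr Normc.normc0.
Qed.

(** Passing to real-valued members makes square roots and minima available. *)
Lemma ratcl_real_uniform_algebra :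
  uniform_algebra D [set u : R[i] -> R | A (fun z => (u z)%:C%C)].
Proof.
split => /=.
- move=> c; exact: ratcl_cst.
- by move=> u v Au Av; apply: ratcl_eq (ratclD Au Av) _ => z _; rewrite raddfD.
- by move=> u v Au Av; apply: ratcl_eq (ratclM Au Av) _ => z _; rewrite rmorphM.
- move=> u /(rat_uniform_closure_CD Cf Cg)/compact_CD_bounded[M uM].
  by exists M => x /uM; rewrite normc_real.
- move=> u H; apply: ratcl_closed => e /H[v Av uv].
  by exists (fun z => (v z)%:C%C) => // z Dz; rewrite /cdist -rmorphB normc_real uv.
Qed.

(** The coordinates yield the distance functions by a square root; cones built on these approximate
    the real and imaginary parts of [h], which are then recombined. *)
Lemma ratcl_CD :
  A (fun z => (complex.Re z)%:C%C) -> A (fun z => (complex.Im z)%:C%C) ->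
  forall h, CD D h -> A h.
Proof.
move=> ARe AIm.
have algA := ratcl_real_uniform_algebra.
set B := [set u | _] in algA.
have Bd y : D y -> B (cdist y).
  move=> _.
  have Bsq (u : R[i] -> R) (c : R) : B u -> B (fun z => (c - u z) ^+ 2).
    move=> Bu; under eq_fun do rewrite expr2.
    by apply: (ualgM algA); apply: (ualgB algA) => //; exact: (ualg_cst algA).
  have : B (fun z => (complex.Re y - complex.Re z) ^+ 2 +
                     (complex.Im y - complex.Im z) ^+ 2).
    by apply: (ualgD algA); exact: Bsq.
  move=> /(ualg_sqrt algA) /(_ (fun z _ => addr_ge0 (sqr_ge0 _) (sqr_ge0 _))) Bn.
  by apply: (ualg_eq algA Bn) => z _; case: y {Bn} => a b; case: z.
have Bcts (u : R[i] -> R) : CD D (fun z => (u z)%:C%C) -> B u.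
  move=> Cu; apply: (ualg_unif_continuous algA Bd).
  - by move=> x y; exact: normc_ge0.
  - exact: compact_cdist_net.
  - move=> e e0; have [k k0 hk] := compact_CD_unif Cu e0; exists k => // x y Dx Dy yx.
    by have := hk x y Dx Dy yx; rewrite /cdist -rmorphB normc_real.
move=> h /continuous_within_cdist Ch.
have BRe : B (fun z => complex.Re (h z)).
  apply/Bcts/continuous_within_cdist => z Dz e e0.
  have F : Filter (within D (nbhs z)) by apply: within_filter.
  apply: filterS (Ch z Dz e e0) => w; apply: le_lt_trans.
  by rewrite /cdist -rmorphB normc_real -raddfB; exact: normc_Re.
have BIm : B (fun z => complex.Im (h z)).
  apply/Bcts/continuous_within_cdist => z Dz e e0.
  have F : Filter (within D (nbhs z)) by apply: within_filter.
  apply: filterS (Ch z Dz e e0) => w; apply: le_lt_trans.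
  by rewrite /cdist -rmorphB normc_real -raddfB; exact: normc_Im.
apply: ratcl_eq (ratclD BRe (ratclM (ratcl_cst 'i%C) BIm)) _ => z _.
by rewrite -complexE.
Qed.

End CompactCD.

(** * From the conjugate and the square to the identity function on a small disk *)

Lemma normc_sqrE (R : realType) (z : R[i]) : (normc z ^+ 2)%:C%C = z * z^*.
Proof. by rewrite rmorphXn; exact: sqr_normc. Qed.

(** The power does not decay near s = 0, but there the factor s is small. For s >= e, a Bernoulli
    estimate bounds the product by s / (1 + N s^2), which is below e since N e^2 > 1. *)
Lemma mul_one_sub_sqr_exp (R : realType) (N : nat) (e s : R) :
  0 < e -> 1 < N%:R * e ^+ 2 -> 0 <= s <= 1 ->
  s * (1 - s ^+ 2) ^+ N < e.
Proof.
move=> e0 Ne /andP[s0 s1].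
have v0 : 0 <= 1 - s ^+ 2 by rewrite subr_ge0 expr_le1.
have bern n : (1 - s ^+ 2) ^+ n * (1 + n%:R * s ^+ 2) <= 1.
  elim: n => [|n IH]; first by rewrite expr0 mul1r mul0r addr0.
  apply: le_trans IH; rewrite exprSr -mulrA; apply: ler_wpM2l; first exact: exprn_ge0.
  rewrite -natr1; have := sqr_ge0 s; have : 0 <= n%:R :> R by [].
  by move: (n%:R) (s ^+ 2) => a b a0 b0; nra.
have [se|es] := ltP s e.
  apply: le_lt_trans se.
  by rewrite -[leRHS]mulr1 ler_wpM2l // exprn_ile1 // gerBl sqr_ge0.
have s2 : 0 < s by apply: lt_le_trans es.
have := bern N; have : 0 <= (1 - s ^+ 2) ^+ N by apply: exprn_ge0.
move: (_ ^+ N) => t t0 tN.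
have : s < e * (1 + N%:R * s ^+ 2).
  have : e * (N%:R * s ^+ 2) * e >= s * (N%:R * e ^+ 2) * e.
    rewrite -subr_ge0.
    have -> : e * (N%:R * s ^+ 2) * e - s * (N%:R * e ^+ 2) * e =
        N%:R * (s * (s - e)) * e ^+ 2 by ring.
    by rewrite !mulr_ge0 ?sqr_ge0 // ?subr_ge0 // ltW.
  nra.
have P : 0 < 1 + N%:R * s ^+ 2 by rewrite ltr_pwDl // mulr_ge0 // sqr_ge0.
move=> H; rewrite -(ltr_pM2r P); apply: le_lt_trans H; rewrite -mulrA -[leRHS]mulr1.
exact: ler_wpM2l.
Qed.

Section SmallDisk.
Variables (R : realType) (r : R).
Hypothesis r_le : r <= 1 / 2.
Local Notation D := (closed_disk r : set R[i]).
Local Notation A := (rat_uniform_closure (@fz R) (@gz R) D).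

Lemma CD_fz : CD D (@fz R).
Proof.
(* Written as a rational function of the identity, so that [CD_rational] applies. *)
have -> : @fz R = fun z => ('X^2)%:P.[z%:P].[z] / 1%:P%:P.[z%:P].[z].
  by apply/funext => z; rewrite !hornerC divr1 hornerXn.
by apply: CD_rational => [||z _]; rewrite ?hornerC ?oner_neq0 //; exact: CD_isometry.
Qed.

Lemma conj_neqN1 z : D z -> 1 + z^* != 0.
Proof.
move=> /closed_diskP zr; apply/eqP => /eqP; rewrite addrC addr_eq0 => /eqP z1.
by move: zr; rewrite -normc_conj z1 normcN Normc.normc1; have := r_le; lra.
Qed.

Lemma CD_gz : CD D (@gz R).
Proof.
have -> : @gz R = fun z => 'X.[(z^*)%:P].[z] / (1%:P%:P + 'X).[(z^*)%:P].[z].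
  by apply/funext => z; rewrite hornerD hornerX hornerC hornerD !hornerC.
apply: CD_rational => [||z Dz]; first exact: CD_isometry.
  by apply: CD_isometry => z w; rewrite /cdist -rmorphB normc_conj.
by rewrite hornerD hornerX hornerC hornerD !hornerC; exact: conj_neqN1.
Qed.

Let cD := @compact_closed_disk R r.
Let rD := ratclD (f := @fz R) (g := @gz R) (D := D).
Let rM := ratclM cD CD_fz CD_gz.

Lemma ratcl_conj : A (fun z => z^*).
Proof.
apply: (@ratcl_exact _ _ _ _ 'X (1%:P%:P - 'X)) => z Dz.
rewrite hornerD hornerN !hornerX !hornerC hornerD hornerN !hornerC.
have z0 := conj_neqN1 Dz.
have -> : 1 - gz z = (1 + z^*)^-1 by rewrite /gz; field.
by rewrite invr_neq0 // invrK /gz divfK.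
Qed.

Let algB := ratcl_real_uniform_algebra cD CD_fz CD_gz.

Lemma ratcl_sqr_normc : A (fun z => (normc z ^+ 2)%:C%C).
Proof.
pose u (z : R[i]) := normc z ^+ 2 * normc z ^+ 2.
have Au : A (fun z => (u z)%:C%C).
  apply: ratcl_eq (rM (ratcl_fst _ _ _) (rM ratcl_conj ratcl_conj)) _ => z _.
  by rewrite /u rmorphM /= normc_sqrE /fz; ring.
apply: (ualg_eq algB (ualg_sqrt algB Au _)) => [z _|z _].
  by rewrite /u -expr2 sqr_ge0.
by rewrite /u -expr2 sqrtr_sqr ger0_norm // sqr_ge0.
Qed.

(** This sum is the cofactor of |z|^2 in 1 - (1 - |z|^2)^N. *)
Lemma ratcl_geom N : A (fun z => (\sum_(i < N) (1 - normc z ^+ 2) ^+ i)%:C%C).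
Proof.
pose B : set (R[i] -> R) := [set u | A (fun z => (u z)%:C%C)].
have Bv : B (fun z => 1 - normc z ^+ 2).
  by apply: (ualgB algB); [exact: ualg_cst algB _|exact: ratcl_sqr_normc].
have Bpow i : B (fun z => (1 - normc z ^+ 2) ^+ i).
  elim: i => [|i IH]; first by under eq_fun do rewrite expr0; exact: ualg_cst algB _.
  by under eq_fun do rewrite exprS; exact: ualgM algB _ _ Bv IH.
change (B (fun z => \sum_(i < N) (1 - normc z ^+ 2) ^+ i)).
elim: N => [|N IH]; first by under eq_fun do rewrite big_ord0; exact: ualg_cst algB _.
by under eq_fun do rewrite big_ord_recr; exact: ualgD algB _ _ IH (Bpow N).
Qed.

(** The product of conj z and [fz z] is z |z|^2. Since |z|^2 vanishes at 0, it cannot be divided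
    out; the geometric sum acts as an approximate inverse, and the factor z absorbs the error near
    0. *)
Lemma ratcl_id : A id.
Proof.
apply: ratcl_closed => e e0.
have : 0 <= 1 / e ^+ 2 by rewrite divr_ge0 // sqr_ge0.
move=> /archi_boundP; set N := Num.bound _; rewrite ltr_pdivrMr ?exprn_gt0 // => Ne.
exists (fun z => z^* * fz z * (\sum_(i < N) (1 - normc z ^+ 2) ^+ i)%:C%C).
  by apply: rM; [apply: rM; [exact: ratcl_conj|exact: (ratcl_fst _ _ _)]|exact: ratcl_geom].
move=> z /closed_diskP zr.
have : normc z * (1 - normc z ^+ 2) ^+ N < e.
  apply: mul_one_sub_sqr_exp => //; rewrite normc_ge0 /=.
  by have := r_le; lra.
apply: le_lt_trans.
have -> : z^* * fz z * (\sum_(i < N) (1 - normc z ^+ 2) ^+ i)%:C%C =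
    z * (1 - (1 - normc z ^+ 2) ^+ N)%:C%C.
  have -> (v : R) : 1 - (1 - v) ^+ N = v * \sum_(i < N) (1 - v) ^+ i.
    by have := subrX1 (1 - v) N; rewrite addrAC subrr add0r; lra.
  rewrite rmorphM /= normc_sqrE /fz expr2.
  by ring.
rewrite /cdist /= -{1}[z]mulr1 -mulrBr Normc.normcM ler_wpM2l ?normc_ge0 //.
rewrite -[X in normc (X - _)](rmorph1 (real_complex R)) -rmorphB normc_real.
rewrite opprB addrC subrK ger0_norm //.
by rewrite exprn_ge0 // subr_ge0 expr_le1 ?normc_ge0 //; have := r_le; lra.
Qed.

Lemma ratcl_Re : A (fun z => (complex.Re z)%:C%C).
Proof.
apply: ratcl_eq (rM (rD ratcl_id ratcl_conj) (ratcl_cst _ _ _ (2^-1))) _ => z _.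
by rewrite ReJ_add.
Qed.

Lemma ratcl_Im : A (fun z => (complex.Im z)%:C%C).
Proof.
have AIm := rD ratcl_conj (rM (ratcl_cst _ _ _ (-1)) ratcl_id).
apply: ratcl_eq (rM AIm (ratcl_cst _ _ _ (2^-1 * 'i%C))) _ => z _.
by rewrite ImJ_sub mulN1r mulrA.
Qed.

End SmallDisk.

Theorem theorem1p1 (R : realType) :
  exists r0 : R, 0 < r0 /\
    forall r : R, 0 < r -> r <= r0 ->
      forall h : R[i] -> R[i],
        rat_uniform_closure (@fz R) (@gz R) (closed_disk r) h <->
        CD (closed_disk r) h.
Proof.
(* On a disk of radius at most 1 / 2, 1 + conj z does not vanish and |z| <= 1; these are the two
   facts drawn from smallness. *)
exists (1 / 2); split=> [|r _ r2 h]; first lra.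
have Cf := @CD_fz R r; have Cg := CD_gz r2.
split; first exact: rat_uniform_closure_CD.
apply: (ratcl_CD (@compact_closed_disk R r) Cf Cg); first exact: ratcl_Re.
exact: ratcl_Im.
Qed.
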